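(* There is an absolute constant $c>0$ such that the following holds. Let $G$ be a finite abelian group and let $\Phi\subset G$ be a set of density $\delta:=|\Phi|/|G|$ satisfying $$\max_{\gamma\in\hat G,\ \gamma\neq 1}\Big|\sum_{x\in\Phi}\gamma(x)\Big|\le \delta^2|\Phi|.$$ Let $\eta>0$ and let $f:G\to\mathbb{C}$ satisfy $|f(x)|\le1$ for all $x$ and $\{x:f(x)\ne0\}\subset\Phi$. If $\|f\|_{U^2}\ge\eta\|1_\Phi\|_{U^2}$, then there exists $\gamma\in\hat G$ with $$\Big|\sum_{x\in\Phi}f(x)\gamma(x)\Big|\ge c\,\eta^4|\Phi|.$$
   Context: $\hat G$ denotes the group of characters of $G$ (homomorphisms $G\to\{z\in\mathbb{C}:|z|=1\}$), and $1$ the trivial character. For $f:G\to\mathbb{C}$, $\|f\|_{U^2}^4:=\sum_{x,h_1,h_2\in G}f(x)\overline{f(x+h_1)f(x+h_2)}f(x+h_1+h_2)$. *)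

(* Defs.v *)
From mathcomp Require Import all_boot all_order all_algebra.
From mathcomp Require Import complex reals.

Set Implicit Arguments.
Unset Strict Implicit.
Unset Printing Implicit Defensive.

Import Order.TTheory GRing.Theory Num.Theory.
Local Open Scope ring_scope.
Local Open Scope complex_scope.

Section FiniteAbelianGroup.
Variables (R : realType) (G : finZmodType).

Definition is_character (gamma : G -> R[i]) : Prop :=
  (forall x, `|gamma x| = 1) /\
  (forall x y, gamma (x + y) = gamma x * gamma y).

Definition trivial_character : G -> R[i] := fun=> 1.

Definition indicator (A : {set G}) : G -> R[i] := fun x => (x \in A)%:R.

Definition density (A : {set G}) : R := #|A|%:R / #|{: G}|%:R.

Definition U2_sum (f : G -> R[i]) : R[i] :=
  \sum_(x : G) \sum_(h1 : G) \sum_(h2 : G)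
    f x * (f (x + h1) * f (x + h2))^*%R * f (x + h1 + h2).

(* On a nonnegative real, [4.-root] is the nonnegative real fourth root; by
   [U2_sum_ge0] this is the case here, so [U2_norm f] is a nonnegative real
   (as an element of [R[i]]). *)
Definition U2_norm (f : G -> R[i]) : R[i] := 4.-root (U2_sum f).

Lemma U2_sum_ge0 (f : G -> R[i]) : 0 <= U2_sum f.
Proof.
have -> : U2_sum f = \sum_(h : G) `|\sum_(x : G) f x * (f (x + h))^*%R| ^+ 2.
  rewrite /U2_sum exchange_big; apply: eq_bigr => h _ /=.
  rewrite normCK mulr_suml; apply: eq_bigr => x _.
  rewrite rmorph_sum mulr_sumr [RHS](reindex_inj (addrI x)) /=.
  apply: eq_bigr => k _; rewrite !rmorphM /= conjCK addrAC.
  by rewrite !mulrA.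
by apply: sumr_ge0 => h _; rewrite exprn_ge0.
Qed.

Lemma U2_norm_ge0 (f : G -> R[i]) : 0 <= U2_norm f.
Proof. by rewrite rootC_ge0 ?U2_sum_ge0. Qed.

Lemma U2_normX4 (f : G -> R[i]) : U2_norm f ^+ 4 = U2_sum f.
Proof. by rewrite rootCK. Qed.

End FiniteAbelianGroup.

Arguments trivial_character {R G}.
Arguments indicator R {G} A.
Arguments density R {G} A.

(* Main.v *)
Require Import Defs.
From mathcomp Require Import all_boot all_order all_algebra.
From mathcomp Require Import fingroup cyclic separable cyclotomic algC.
From mathcomp Require Import classfun character.
From mathcomp Require Import complex reals ring.

(* Write F for the Fourier transform of f, P = |Phi|, N = |G| and
   S = sum |F|^3 over the dual group. By Parseval N ||f||_{U^2}^4 = sum |F|^4.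
   Testing f against the trigonometric polynomial with coefficients |F| conj F,
   Cauchy-Schwarz on Phi and the bias hypothesis give
     S^2 <= P (P sum |F|^4 + (P/N)^2 P (sum |F|^2)^2) <= P^3 S + P^6,
   since |F| <= P and sum |F|^2 <= N P; hence S <= 2 P^3. Therefore
     eta^4 P^4 <= sum |F|^4 <= max |F| * S <= 2 P^3 max |F|. *)

Set Implicit Arguments.
Unset Strict Implicit.
Unset Printing Implicit Defensive.

Import Order.TTheory GRing.Theory Num.Theory.
Local Open Scope ring_scope.

(** * Roots of unity and the dual group of a finite abelian group *)

Lemma prim_root_exists (F : closedFieldType) (n : nat) :
  n%:R != 0 :> F -> exists z : F, n.-primitive_root z.
Proof.
move=> n_neq0; have n_gt0 : (0 < n)%N by case: n n_neq0 => //; rewrite eqxx.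
pose p : {poly F} := 'X^n - 1; have [r Dp] := closed_field_poly_normal p.
rewrite (monicP _) ?monicXnsubC // scale1r in Dp.
have rn1 : all n.-unity_root r by apply/allP=> z; rewrite -root_prod_XsubC -Dp.
have sz_r : (n < (size r).+1)%N.
  by rewrite -(size_prod_XsubC r id) -Dp size_XnsubC.
have [|z _ zP] := hasP (has_prim_root n_gt0 rn1 _ sz_r); last by exists z.
(* [has_prim_root] asks for [n] distinct roots: ['X^n - 1] is separable because [n] is nonzero in
   [F]. *)
by rewrite -separable_prod_XsubC -Dp separable_Xn_sub_1.
Qed.

(** The kernels of the irreducible characters intersect trivially, and on an abelian group all of
    these characters are linear. *)
Lemma lin_char_separates (gT : finGroupType) (G : {group gT}) (x : gT) :
  abelian G -> x \in G -> x != 1%g ->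
  exists2 xi : 'CF(G), xi \is a linear_char & xi x != 1.
Proof.
move=> abG Gx x_neq1.
have : x \notin \bigcap_i cfker 'chi[G]_i by rewrite TI_cfker_irr inE.
rewrite -in_setC setC_bigcap => /bigcupP[i _]; rewrite inE cfkerEirr inE.
have lin_i := char_abelianP _ abG i.
by rewrite (lin_char1 lin_i); exists 'chi_i.
Qed.

Section Dual.
Variables (C : numClosedFieldType) (G : finZmodType).

(** With the order written as [n.+1], the exponents in ['I_n.+1] form the additive group of integers
    modulo [#|G|], and exponent maps add pointwise. *)
Let n := #|{: G}|.-1.
Let card_G : n.+1 = #|{: G}|.
Proof. by rewrite prednK //; apply/card_gt0P; exists 0. Qed.

(* The characters are the [w ^+ k x], with [w] a primitive root of unity of order
   [#|G|] and [k] a map that is additive modulo [#|G|]. They separate points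
   because the irreducible characters of [G] over [algC] do: the exponents of
   the latter can be reused with [w]. *)
Lemma dual_family_exists : exists (I : finType) (chi : I -> G -> C),
  [/\ forall i j, chi i =1 chi j -> i = j,
      forall i x, `|chi i x| = 1,
      forall i x y, chi i (x + y) = chi i x * chi i y,
      exists i, chi i =1 fun=> 1 &
      forall x, \sum_i chi i x = (#|{: G}| * (x == 0))%:R].
Proof.
have [w prim_w] : exists w : C, n.+1.-primitive_root w.
  by apply: prim_root_exists; rewrite pnatr_eq0.
pose chi (k : {ffun G -> 'I_n.+1}) x := w ^+ k x.
pose D := [set k | [forall x, forall y, chi k (x + y) == chi k x * chi k y]].
have DP k : reflect (forall x y, chi k (x + y) = chi k x * chi k y) (k \in D).
  rewrite inE; apply: (iffP forallP) => [kP x y|kP x].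
    by apply/eqP; apply: (forallP (kP x)).
  by apply/forallP => y; apply/eqP.
have w_neq0 : w != 0 by rewrite (prim_root_eq0 prim_w).
have chi_inj k l : chi k =1 chi l -> k = l.
  move=> eq_kl; apply/ffunP => x; apply/val_inj/eqP.
  have := eq_prim_root_expr prim_w (k x) (l x).
  by rewrite !modn_small // => <-; apply/eqP; apply: eq_kl.
have chi0 : chi 0 =1 fun=> 1 by move=> x; rewrite /chi ffunE.
have chiD k l x : chi (k + l) x = chi k x * chi l x.
  by rewrite /chi ffunE /= prim_expr_mod // exprD.
have D0 : 0 \in D by apply/DP => x y; rewrite !chi0 mulr1.
have DD k l : k \in D -> l \in D -> k + l \in D.
  by move=> /DP kP /DP lP; apply/DP => x y; rewrite !chiD kP lP mulrACA.
have DN k : k \in D -> - k \in D.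
  move=> /DP kP; apply/DP => x y.
  have chi_neq0 z : chi k z != 0 by rewrite expf_neq0.
  apply: (mulfI (chi_neq0 (x + y))); rewrite -chiD subrr chi0.
  by rewrite kP mulrACA -!chiD subrr !chi0 mulr1.
have sep x : x != 0 -> exists2 k, k \in D & chi k x != 1.
  move=> x_neq0.
  have [xi lin_xi xi_x] := @lin_char_separates G [set: G]%G x
    (FinRing.zmod_abelian _) (in_setT _) x_neq0.
  have [z prim_z] : exists z : algC, n.+1.-primitive_root z.
    by apply: prim_root_exists; rewrite pnatr_eq0.
  have xiX y : xi y ^+ n.+1 = 1.
    by rewrite -(lin_charX lin_xi) ?inE // card_G -cardsT expg_cardG ?inE //
      lin_char1.
  pose k := [ffun y => sval (prim_rootP prim_z (xiX y))].
  have kE y : xi y = z ^+ k y by rewrite ffunE; case: prim_rootP.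
  exists k; last first.
    rewrite /chi -(prim_order_dvd prim_w) (prim_order_dvd prim_z).
    by rewrite -kE.
  (* Equality of two powers of a primitive root depends only on the exponents modulo [n.+1], so
     multiplicativity passes from [z] in [algC] to [w] in [C]. *)
  apply/DP => y y'; rewrite /chi -exprD; apply/eqP.
  rewrite (eq_prim_root_expr prim_w) -(eq_prim_root_expr prim_z) exprD -!kE.
  by rewrite -(lin_charM lin_xi) ?inE.
(* Translating [D] by an [l] with [chi l x != 1] multiplies the sum by [chi l x], so the sum
   vanishes. The same device, with [G] translated by [y], gives [sumG]. *)
have sumD x : x != 0 -> \sum_(k in D) chi k x = 0.
  move=> /sep[l lD l_x]; apply/eqP.
  suff : (1 - chi l x) * \sum_(k in D) chi k x == 0.
    by rewrite mulf_eq0 subr_eq0 eq_sym (negPf l_x).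
  rewrite mulrBl mul1r subr_eq0 mulr_sumr; apply/eqP.
  rewrite (reindex_inj (addrI l)); apply: eq_big => k /=; last by rewrite chiD.
  apply/idP/idP => [lkD|]; last exact: DD.
  by rewrite -(addKr l k) DD // DN.
have sumG k : k \in D -> \sum_x chi k x = (n.+1 * (k == 0))%:R.
  move=> kD; have [->|k_neq0] := eqVneq k 0.
    by rewrite (eq_bigr (fun=> 1)) // sumr_const muln1 card_G.
  rewrite muln0; have /existsP[y k_y] : [exists y, chi k y != 1].
    apply: contraNT k_neq0 => /existsPn k1; apply/eqP/chi_inj => x.
    by rewrite chi0; have := k1 x; rewrite negbK => /eqP.
  apply/eqP; suff : (1 - chi k y) * \sum_x chi k x == 0.
    by rewrite mulf_eq0 subr_eq0 eq_sym (negPf k_y).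
  rewrite mulrBl mul1r subr_eq0 mulr_sumr; apply/eqP.
  rewrite (reindex_inj (addrI y)); apply: eq_bigr => x _ /=.
  by move/DP: kD => ->.
have sum_chi0 : \sum_(k in D) chi k 0 = #|D|%:R.
  rewrite -sum1_card natr_sum; apply: eq_bigr => k /DP kP.
  have := kP 0 0; rewrite addr0 -[LHS]mulr1 => /mulfI <- //.
  by rewrite expf_neq0.
(* Double counting: summing over [k] first leaves only [x = 0], with value [#|D|]; summing over [x]
   first leaves only [k = 0], with value [#|G|]. *)
have card_D : #|D|%:R = #|{: G}|%:R :> C.
  rewrite -card_G; transitivity (\sum_(k in D) \sum_x chi k x).
    rewrite exchange_big (bigD1 0) //= [X in _ + X]big1 ?addr0.
      by rewrite sum_chi0.
    by move=> x /sumD.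
  rewrite (bigD1 (0 : {ffun G -> 'I_n.+1})) //= sumG // eqxx muln1.
  rewrite big1 ?addr0 // => k /andP[kD k0].
  by rewrite sumG // (negPf k0) muln0.
exists 'I_#|D|, (fun i => chi (enum_val i)); split.
- by move=> i j /chi_inj/enum_val_inj.
- move=> i x; apply/eqP; rewrite -(@pexpr_eq1 _ _ n.+1) // /chi -normrX.
  by rewrite exprAC (prim_expr_order prim_w) expr1n normr1.
- by move=> i; apply/DP/enum_valP.
- by exists (enum_rank_in D0 0) => x; rewrite enum_rankK_in.
- move=> x; rewrite -(big_enum_val (fun k => chi k x)) /=.
  have [->|x_neq0] := eqVneq x 0; last by rewrite muln0 sumD.
  by rewrite muln1 sum_chi0 card_D.
Qed.
End Dual.
(** Cauchy-Schwarz against the constant 1, obtained by summing [2 u(x) u(y) <= u(x)^2 + u(y)^2] over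
    all pairs in [A]. *)
Lemma sqr_sum_le (F : numFieldType) (T : finType) (A : {set T}) (u : T -> F) :
  (forall x, 0 <= u x) ->
  (\sum_(x in A) u x) ^+ 2 <= #|A|%:R * \sum_(x in A) u x ^+ 2.
Proof.
move=> u_ge0; rewrite -(@ler_pMn2r _ 2) // expr2 mulr_suml -sumrMnl.
have -> : (#|A|%:R * \sum_(x in A) u x ^+ 2) *+ 2 =
    \sum_(x in A) \sum_(y in A) (u x ^+ 2 + u y ^+ 2).
  under [RHS]eq_bigr => x _ do rewrite big_split sumr_const /=.
  by rewrite big_split sumrMnl sumr_const mulr_natl mulr2n.
apply: ler_sum => x _; rewrite mulr_sumr -sumrMnl; apply: ler_sum => y _.
by apply: real_leif_mean_square_scaled; apply: ger0_real.
Qed.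

(** * Fourier transform and Parseval identities *)

Section Fourier.
Variables (C : numClosedFieldType) (G : finZmodType) (I : finType).
Variable chi : I -> G -> C.
Hypothesis norm_chi : forall i x, `|chi i x| = 1.
Hypothesis chiD : forall i x y, chi i (x + y) = chi i x * chi i y.
Hypothesis sum_chi : forall x, \sum_i chi i x = (#|{: G}| * (x == 0))%:R.

(** Taken without conjugation or normalisation, so that for [f] supported on [Phi] it is the very
    sum to be bounded below. *)
Definition fourier (f : G -> C) (i : I) : C := \sum_x f x * chi i x.

Lemma mul_conj_chi i x : chi i x * (chi i x)^* = 1.
Proof. by rewrite -normCK norm_chi expr1n. Qed.

Lemma chiB i x y : chi i (x - y) = chi i x * (chi i y)^*.
Proof. by rewrite -[in RHS](subrK y x) [in RHS]chiD -mulrA mul_conj_chi mulr1. Qed.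

Lemma parseval f : \sum_i `|fourier f i| ^+ 2 = #|{: G}|%:R * \sum_x `|f x| ^+ 2.
Proof.
transitivity (\sum_i \sum_x \sum_y f x * (f y)^* * chi i (x - y)).
  apply: eq_bigr => i _; rewrite normCK mulr_suml; apply: eq_bigr => x _.
  rewrite rmorph_sum mulr_sumr; apply: eq_bigr => y _.
  by rewrite rmorphM chiB mulrACA.
rewrite exchange_big mulr_sumr; apply: eq_bigr => x _ /=.
rewrite exchange_big (bigD1 x) //= -mulr_sumr sum_chi subrr eqxx muln1.
rewrite big1 => [|y yx]; first by rewrite addr0 mulrC normCK.
by rewrite -mulr_sumr sum_chi subr_eq0 eq_sym (negPf yx) muln0 mulr0.
Qed.

(** The autocorrelation [A] of [f] has Fourier transform [|F|^2]; applying [parseval] to [A] gives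
    the fourth moment. The right side is [#|G|] times the fourth power of the U2 norm. *)
Lemma parseval4 f :
  \sum_i `|fourier f i| ^+ 4 =
  #|{: G}|%:R * \sum_h `|\sum_x f x * (f (x + h))^*| ^+ 2.
Proof.
pose A h := (\sum_x f x * (f (x + h))^*)^*.
have AE i : fourier A i = `|fourier f i| ^+ 2.
  rewrite normCK mulrC rmorph_sum mulr_suml.
  under [RHS]eq_bigr => x _ do
    rewrite mulr_sumr (reindex_inj (addrI x)) /=.
  rewrite exchange_big; apply: eq_bigr => h _ /=.
  rewrite /A rmorph_sum mulr_suml; apply: eq_bigr => x _.
  rewrite !rmorphM /= conjCK mulrACA chiD (mulrA (_^*)).
  by rewrite [_^* * chi i x]mulrC mul_conj_chi mul1r.
transitivity (\sum_i `|fourier A i| ^+ 2).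
  by apply: eq_bigr => i _; rewrite AE normrX normr_id -exprM.
by rewrite parseval; congr (_ * _); apply: eq_bigr => h _; rewrite norm_conjC.
Qed.

(** * Large sieve inequality on a set with small character correlations *)

Section Restriction.
Variables (A : {set G}) (d : C).
Hypothesis d_ge0 : 0 <= d.
Hypothesis corr_chi : forall i j, i != j ->
  `|\sum_(x in A) chi i x * (chi j x)^*| <= d.

(** Expanding the square, the diagonal pairs contribute exactly the first term on the right, and
    each inner sum off the diagonal is at most [d]. *)
Lemma large_sieve (c : I -> C) :
  \sum_(x in A) `|\sum_i c i * chi i x| ^+ 2 <=
  #|A|%:R * (\sum_i `|c i| ^+ 2) + d * (\sum_i `|c i|) ^+ 2.
Proof.
have E : \sum_(x in A) `|\sum_i c i * chi i x| ^+ 2 =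
    \sum_i \sum_j c i * (c j)^* * \sum_(x in A) chi i x * (chi j x)^*.
  under eq_bigr => x _ do rewrite normCK mulr_suml.
  rewrite exchange_big; apply: eq_bigr => i _ /=.
  under [RHS]eq_bigr => j _ do rewrite mulr_sumr.
  rewrite [RHS]exchange_big; apply: eq_bigr => x _ /=.
  rewrite rmorph_sum mulr_sumr; apply: eq_bigr => j _.
  by rewrite rmorphM mulrACA.
have lhs_ge0 : 0 <= \sum_(x in A) `|\sum_i c i * chi i x| ^+ 2.
  by apply: sumr_ge0 => x _; rewrite exprn_ge0.
rewrite -(ger0_norm lhs_ge0) E expr2 mulr_suml !mulr_sumr -big_split /=.
apply: le_trans (ler_norm_sum _ _ _) _; apply: ler_sum => i _.
apply: le_trans (ler_norm_sum _ _ _) _; rewrite (bigD1 i) //=; apply: lerD.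
  rewrite (eq_bigr (fun=> 1)) => [|x _]; last exact: mul_conj_chi.
  by rewrite sumr_const normrM normr_nat -normCK ger0_norm ?exprn_ge0 // mulrC.
have term_ge0 j : 0 <= d * (`|c i| * `|c j|) by rewrite !mulr_ge0.
(* The nonnegative term [j = i] is added back to complete the square of the sum of the [|c i|]. *)
rewrite !mulr_sumr [leRHS](bigD1 i) //= -[leLHS]add0r; apply: lerD => //.
apply: ler_sum => j ji; rewrite !normrM norm_conjC mulrC.
by rewrite ler_wpM2r ?mulr_ge0 // corr_chi // eq_sym.
Qed.

(* Duality: [sum |F_i|^3 = sum_(x in A) f x * g x], where [g] is the
   trigonometric polynomial with coefficients [|F_i| * (F_i)^*]. *)
Lemma sqr_sum_cube_le (f : G -> C) :
    (forall x, `|f x| <= 1) -> (forall x, f x != 0 -> x \in A) ->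
  (\sum_i `|fourier f i| ^+ 3) ^+ 2 <=
  #|A|%:R * (#|A|%:R * (\sum_i `|fourier f i| ^+ 4)
             + d * (\sum_i `|fourier f i| ^+ 2) ^+ 2).
Proof.
move=> f_le1 fA; pose c i := `|fourier f i| * (fourier f i)^*.
have norm_c i : `|c i| = `|fourier f i| ^+ 2.
  by rewrite normrM normr_id norm_conjC.
have dualE : \sum_i `|fourier f i| ^+ 3 =
    \sum_(x in A) f x * \sum_i c i * chi i x.
  transitivity (\sum_x f x * \sum_i c i * chi i x).
    under [RHS]eq_bigr => x _ do rewrite mulr_sumr.
    rewrite exchange_big; apply: eq_bigr => i _ /=.
    under eq_bigr => x _ do rewrite mulrCA.
    by rewrite -mulr_sumr exprS normCK -mulrA [_^* * _]mulrC.
  rewrite [RHS]big_mkcond; apply: eq_bigr => x _; case: ifP => // xA.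
  have [->|/fA] := eqVneq (f x) 0; first by rewrite mul0r.
  by rewrite xA.
have sum4 : \sum_i `|fourier f i| ^+ 4 = \sum_i `|c i| ^+ 2.
  by apply: eq_bigr => i _; rewrite norm_c -exprM.
under [X in d * X ^+ 2]eq_bigr => i _ do rewrite -norm_c.
have S_ge0 : 0 <= \sum_i `|fourier f i| ^+ 3.
  by apply: sumr_ge0 => i _; rewrite exprn_ge0.
rewrite sum4 -(ger0_norm S_ge0) dualE.
apply: le_trans (ler_wpM2l (ler0n _ _) (large_sieve c)).
apply: le_trans (sqr_sum_le _ (fun x => normr_ge0 _)).
rewrite lerXn2r ?nnegrE ?sumr_ge0 //.
apply: le_trans (ler_norm_sum _ _ _) _; apply: ler_sum => x _.
by rewrite normrM ler_piMl.
Qed.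
End Restriction.

(** * Third moment bound and existence of a large Fourier coefficient *)

Lemma norm_fourier_le (A : {set G}) (f : G -> C) i :
    (forall x, `|f x| <= 1) -> (forall x, f x != 0 -> x \in A) ->
  `|fourier f i| <= #|A|%:R.
Proof.
move=> f_le1 fA; apply: le_trans (ler_norm_sum _ _ _) _.
rewrite -sum1_card natr_sum [leRHS]big_mkcond; apply: ler_sum => x _.
rewrite normrM norm_chi mulr1; case: ifP => // xA.
have [->|/fA] := eqVneq (f x) 0; first by rewrite normr0.
by rewrite xA.
Qed.

(* By Parseval the off-diagonal term of [sqr_sum_cube_le] is at most [#|A| ^+ 6]:
   the bound [density ^+ 2 * #|A|] is exactly what this requires. *)
Lemma sum_cube_le (A : {set G}) (f : G -> C) :
    (forall i j, i != j -> `|\sum_(x in A) chi i x * (chi j x)^*| <=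
       (#|A|%:R / #|{: G}|%:R) ^+ 2 * #|A|%:R) ->
    (forall x, `|f x| <= 1) -> (forall x, f x != 0 -> x \in A) ->
  \sum_i `|fourier f i| ^+ 3 <= 2 * #|A|%:R ^+ 3.
Proof.
move=> corrA f_le1 fA; set P : C := #|A|%:R; set S := \sum_i _.
have N_gt0 : 0 < #|{: G}|%:R :> C by rewrite ltr0n; apply/card_gt0P; exists 0.
have P_ge0 : 0 <= P by rewrite ler0n.
have S_ge0 : 0 <= S by apply: sumr_ge0 => i _; rewrite exprn_ge0.
have d_ge0 : 0 <= (P / #|{: G}|%:R) ^+ 2 * P.
  by rewrite mulr_ge0 // exprn_ge0 // divr_ge0 // ltW.
have := sqr_sum_cube_le d_ge0 corrA f_le1 fA; rewrite -/S -/P => SSle.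
have sum2 : \sum_i `|fourier f i| ^+ 2 <= #|{: G}|%:R * P.
  rewrite parseval ler_pM2l // /P -sum1_card natr_sum [leRHS]big_mkcond.
  apply: ler_sum => x _; case: ifP => xA; first by rewrite expr_le1.
  have [->|/fA] := eqVneq (f x) 0; first by rewrite normr0 expr0n.
  by rewrite xA.
have sum2_ge0 : 0 <= \sum_i `|fourier f i| ^+ 2.
  by apply: sumr_ge0 => i _; rewrite exprn_ge0.
have sum4 : \sum_i `|fourier f i| ^+ 4 <= P * S.
  rewrite mulr_sumr; apply: ler_sum => i _; rewrite exprS ler_wpM2r ?exprn_ge0 //.
  exact: norm_fourier_le.
have {}SSle : S ^+ 2 <= P ^+ 3 * S + P ^+ 6.
  apply: le_trans SSle _; rewrite mulrDr; apply: lerD.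
    rewrite exprSr expr2 -!mulrA !ler_wpM2l //.
  have -> : P ^+ 6 = P * ((P / #|{: G}|%:R) ^+ 2 * P * (#|{: G}|%:R * P) ^+ 2).
    by field; rewrite gt_eqF.
  by rewrite !ler_wpM2l // lerXn2r // nnegrE // mulr_ge0 // ltW.
have P3_ge0 : 0 <= P ^+ 3 by rewrite exprn_ge0.
(* If [S > 2 P^3], then [P^6 <= P^3 S], so the right side of [SSle] is at most [2 P^3 S < S^2]. *)
rewrite real_leNgt ?ger0_real ?mulr_ge0 //; apply: contraTN SSle => ltS.
rewrite -real_ltNge ?ger0_real ?addr_ge0 ?mulr_ge0 ?exprn_ge0 //.
have S_gt0 : 0 < S by apply: le_lt_trans ltS; rewrite mulr_ge0.
have P6 : P ^+ 6 <= P ^+ 3 * S.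
  rewrite (exprD P 3 3) ler_wpM2l //; apply: le_trans (ltW ltS).
  by rewrite ler_peMl // ler1n.
apply: le_lt_trans (lerD (lexx _) P6) _.
by rewrite -mulr2n -mulr_natl mulrA expr2 ltr_pM2r.
Qed.

Lemma fourier_large (A : {set G}) (f : G -> C) (eta : C) :
    (exists i, chi i =1 fun=> 1) ->
    (forall i j, i != j -> `|\sum_(x in A) chi i x * (chi j x)^*| <=
       (#|A|%:R / #|{: G}|%:R) ^+ 2 * #|A|%:R) ->
    (forall x, `|f x| <= 1) -> (forall x, f x != 0 -> x \in A) ->
    0 < eta ->
    eta ^+ 4 * \sum_i `|fourier (fun x => (x \in A)%:R) i| ^+ 4 <=
      \sum_i `|fourier f i| ^+ 4 ->
  exists i, 4^-1 * eta ^+ 4 * #|A|%:R <= `|fourier f i|.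
Proof.
move=> [i0 chi_i0] corrA f_le1 fA eta_gt0; set P : C := #|A|%:R => le4.
have [P0|P_neq0] := eqVneq P 0; first by exists i0; rewrite P0 mulr0.
have P_gt0 : 0 < P by rewrite lt_def P_neq0 ler0n.
(* If every coefficient were below [t], the fourth moment would be at most
   [t * 2 P^3 = eta^4 P^4 / 2]. The factor [4^-1] makes this half of the lower bound [eta^4 P^4],
   which is positive: a contradiction. *)
pose t := 4^-1 * eta ^+ 4 * P.
have t_gt0 : 0 < t.
  by apply: mulr_gt0 P_gt0; apply: mulr_gt0; rewrite ?invr_gt0 ?exprn_gt0.
case: (boolP [exists i, t <= `|fourier f i|]) => [/existsP //|].
rewrite negb_exists => /forallP small.
have le_t i : `|fourier f i| <= t.
  by rewrite ltW // real_ltNge ?ger0_real // ltW.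
suff : eta ^+ 4 * P ^+ 4 <= 2^-1 * (eta ^+ 4 * P ^+ 4).
  rewrite ler_pMl ?mulr_gt0 ?exprn_gt0 // invf_ge1 ?ltr0n //.
  by rewrite lern1.
(* The trivial character [i0] alone contributes [P^4]. *)
have lower : P ^+ 4 <= \sum_i `|fourier (fun x => (x \in A)%:R) i| ^+ 4.
  rewrite (bigD1 i0) //=.
  have -> : fourier (fun x => (x \in A)%:R) i0 = P.
    rewrite /P -sum1_card natr_sum [RHS]big_mkcond; apply: eq_bigr => x _.
    by rewrite chi_i0 mulr1; case: ifP.
  by rewrite ger0_norm ?ler0n // lerDl sumr_ge0 // => i _; rewrite exprn_ge0.
apply: le_trans (ler_wpM2l _ lower) _; first by rewrite exprn_ge0 // ltW.
apply: le_trans le4 _.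
apply: (@le_trans _ _ (t * \sum_i `|fourier f i| ^+ 3)).
  by rewrite mulr_sumr; apply: ler_sum => i _; rewrite exprS ler_wpM2r ?exprn_ge0.
apply: le_trans (ler_wpM2l (ltW t_gt0) (sum_cube_le corrA f_le1 fA)) _.
by rewrite le_eqVlt -/P; apply/orP; left; apply/eqP; rewrite /t; field.
Qed.
End Fourier.

(** * Translation to the U2 norm and conclusion *)

Local Open Scope complex_scope.

(** This is the form in which the U2 sum appears in [parseval4]. For fixed [h1 = h], the
    substitution [y = x + h2] splits the sum over [x] and [h2] into a product of two conjugate
    factors. *)
Lemma U2_sumE (R : realType) (G : finZmodType) (f : G -> R[i]) :
  U2_sum f = \sum_h `|\sum_x f x * ((f (x + h))^*)%R| ^+ 2.
Proof.
rewrite /U2_sum exchange_big; apply: eq_bigr => h _ /=.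
rewrite normCK mulr_suml; apply: eq_bigr => x _.
rewrite rmorph_sum mulr_sumr [RHS](reindex_inj (addrI x)) /=.
apply: eq_bigr => k _; rewrite !rmorphM /= conjCK addrAC.
by rewrite !mulrA.
Qed.

Theorem theorem1p7 (R : realType) :
  exists c : R, 0 < c /\
    forall (G : finZmodType) (Phi : {set G}),
      (forall gamma : G -> R[i],
          is_character gamma -> gamma <> trivial_character ->
          `|\sum_(x in Phi) gamma x| <= (density R Phi ^+ 2 * #|Phi|%:R)%:C) ->
      forall (eta : R) (f : G -> R[i]),
        0 < eta ->
        (forall x, `|f x| <= 1) ->
        (forall x, f x != 0 -> x \in Phi) ->
        eta%:C * U2_norm (indicator R Phi) <= U2_norm f ->
        exists2 gamma : G -> R[i], is_character gamma &
          (c * eta ^+ 4 * #|Phi|%:R)%:C <= `|\sum_(x in Phi) f x * gamma x|.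
Proof.
exists 4^-1; split => [|G Phi biasP eta f eta_gt0 f_le1 fP U2_le].
  by rewrite invr_gt0 ltr0n.
have [I [chi [chi_inj norm_chi chiD chi_1 sum_chi]]] :=
  @dual_family_exists R[i] G.
(* The quotient of two distinct characters is a nontrivial character: were it trivial, [chi i] and
   [chi j] would agree everywhere and [chi_inj] would give [i = j]. The bias hypothesis therefore
   bounds all off-diagonal correlations. *)
have corrP i j : i != j -> `|\sum_(x in Phi) chi i x * ((chi j x)^*)%R| <=
    (#|Phi|%:R / #|{: G}|%:R) ^+ 2 * #|Phi|%:R.
  move=> ij; have <- : (density R Phi ^+ 2 * #|Phi|%:R)%:C =
      (#|Phi|%:R / #|{: G}|%:R) ^+ 2 * #|Phi|%:R.
    by rewrite /density rmorphM rmorphXn /= fmorph_div /= !rmorph_nat.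
  apply: biasP.
    split=> [x|x y]; first by rewrite normrM norm_conjC !norm_chi mulr1.
    by rewrite !chiD rmorphM mulrACA.
  move=> triv; case/eqP: ij; apply: chi_inj => x.
  have := congr1 (fun g => g x) triv; rewrite /trivial_character /= => eq1.
  rewrite -[RHS]mul1r -eq1 -mulrA [_^*%R * _]mulrC.
  by rewrite (mul_conj_chi norm_chi) mulr1.
have eta_ge0 : 0 <= eta%:C by rewrite ler0c ltW.
(* The fourth power of the norm hypothesis; [parseval4] brings the same factor [#|G|] to both
   sides. *)
have le4 : eta%:C ^+ 4 *
    \sum_i `|fourier chi (fun x => (x \in Phi)%:R) i| ^+ 4 <=
    \sum_i `|fourier chi f i| ^+ 4.
  rewrite !(parseval4 norm_chi chiD sum_chi) -!U2_sumE mulrCA.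
  rewrite ler_wpM2l ?ler0n // -U2_normX4 -[leRHS]U2_normX4 -exprMn.
  by rewrite lerXn2r // nnegrE ?mulr_ge0 ?U2_norm_ge0.
have [|i le_i] := fourier_large norm_chi chiD sum_chi chi_1 corrP f_le1 fP _ le4.
  by rewrite ltcR.
exists (chi i) => //.
have -> : \sum_(x in Phi) f x * chi i x = fourier chi f i.
  rewrite /fourier big_mkcond; apply: eq_bigr => x _; case: ifP => // xP.
  have [->|/fP] := eqVneq (f x) 0; first by rewrite mul0r.
  by rewrite xP.
by rewrite 2!rmorphM rmorphXn /= fmorphV !rmorph_nat.
Qed.
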